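(* Let $\mathbb{K}$ be a field, $m\ge 1$, $n=2m$, $S=\mathbb{K}[x_1,\ldots,x_n]$, and let $X=X_m^{(1,n)}$ be the $m\times(m+1)$ generic Hankel matrix with entries $x_1,\ldots,x_n$. Let $f=\det X_m^{(1,n-1)}\cdot\det X_m^{(2,n)}\in S$. Then $I_t(X)\in\mathcal{C}_f$ for $t=1,\ldots,m$.
   Context: For integers $l\le n$ and $m$, $X_m^{(l,n)}$ denotes the generic Hankel matrix with $m$ rows and $n-m-l+2$ columns whose $(i,j)$ entry is $x_{l+i+j-2}$ (so its entries are $x_l,\ldots,x_n$). For a matrix $M$, $I_t(M)$ is the ideal of $S$ generated by all $t\times t$ minors of $M$. For $f\in S$, $\mathcal{C}_f$ denotes the smallest set of ideals of $S$ such that: (1) $(f)\in\mathcal{C}_f$; (2) if $I\in\mathcal{C}_f$ then $I:J\in\mathcal{C}_f$ for every ideal $J\subseteq S$; (3) if $I,J\in\mathcal{C}_f$ then $I+J\in\mathcal{C}_f$ and $I\cap J\in\mathcal{C}_f$. *)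

(* Defs.v *)
From HB Require Import structures.
From mathcomp Require Import all_boot all_order all_algebra.
From mathcomp Require Import mpoly.
Set Implicit Arguments. Unset Strict Implicit. Unset Printing Implicit Defensive.
Import GRing.Theory.
Local Open Scope ring_scope.

Definition is_ideal (R : comNzRingType) (I : R -> Prop) : Prop :=
  [/\ I 0, (forall a b, I a -> I b -> I (a + b)) & (forall r a, I a -> I (r * a))].

Definition ideal_gen (R : comNzRingType) (G : R -> Prop) : R -> Prop :=
  fun x => forall I, is_ideal I -> (forall g, G g -> I g) -> I x.

Definition principal (R : comNzRingType) (f : R) : R -> Prop :=
  ideal_gen (fun g => g = f).

Definition colon_ideal (R : comNzRingType) (I J : R -> Prop) : R -> Prop :=
  fun g => forall h, J h -> I (g * h).

Definition sum_ideal (R : comNzRingType) (I J : R -> Prop) : R -> Prop :=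
  fun x => exists a b, [/\ I a, J b & x = a + b].

Definition cap_ideal (R : comNzRingType) (I J : R -> Prop) : R -> Prop :=
  fun x => I x /\ J x.

Definition in_Cf (R : comNzRingType) (f : R) (I : R -> Prop) : Prop :=
  forall C : (R -> Prop) -> Prop,
    C (principal f) ->
    (forall I J, C I -> is_ideal J -> C (colon_ideal I J)) ->
    (forall I J, C I -> C J -> C (sum_ideal I J)) ->
    (forall I J, C I -> C J -> C (cap_ideal I J)) ->
    C I.

Definition minors (R : comNzRingType) (m c t : nat) (M : 'M[R]_(m, c)) : R -> Prop :=
  fun p => exists (r : 'I_t -> 'I_m) (s : 'I_t -> 'I_c),
    [/\ (forall a b : 'I_t, (a < b)%N -> (r a < r b)%N),
        (forall a b : 'I_t, (a < b)%N -> (s a < s b)%N) &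
        p = \det (\matrix_(i < t, j < t) M (r i) (s j))].

Definition minor_ideal (R : comNzRingType) (m c t : nat) (M : 'M[R]_(m, c)) : R -> Prop :=
  ideal_gen (minors t M).

(* The variable x_k (1-indexed) of K[x_1, ..., x_N]; 0 if out of range. *)
Definition xvar (K : fieldType) (N : nat) (k : nat) : {mpoly K[N]} :=
  match k with
  | 0 => 0
  | k'.+1 => match @insub nat (fun i => (i < N)%N) 'I_N k' with
             | Some i => 'X_i
             | None => 0
             end
  end.

(* Generic Hankel matrix X_m^{(l,n)} with c = n - m - l + 2 columns:
   the (i,j) entry (1-indexed) is x_{l+i+j-2}; with 0-indexed i, j it is x_{l+i+j}. *)
Definition hankel (K : fieldType) (N l m c : nat) : 'M[{mpoly K[N]}]_(m, c) :=
  \matrix_(i < m, j < c) xvar K N (l + i + j).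

(* Main.v *)
Require Import Defs.
From HB Require Import structures.
From mathcomp Require Import all_boot all_order all_algebra all_fingroup.
From mathcomp Require Import mpoly zify.
From Stdlib Require Import FunctionalExtensionality PropExtensionality.
Set Implicit Arguments.
Unset Strict Implicit.
Unset Printing Implicit Defensive.
Import GRing.Theory.
Local Open Scope ring_scope.

(** For [t >= 1] let [V t a b] be the prime ideal of the closure of the Hankel
    matrices in [x_a, ..., x_b] of rank less than [t], given parametrically by
    sums of [t - 1] geometric progressions.  A nonzero polynomial without
    monomials that contain [t] of these variables with indices at pairwise distance at least 2
    does not vanish identically on the parametrisation, so any ideal containing
    one [t]-minor for each such chain of diagonal entries contains [V t a b];
    this also makes it easy to see at which points [V t a b] vanishes.

    With [n = 2m], starting from [V m 1 (n-1)] and [V m 2 n], which are quotients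
    of [(f)] by one of its two factors, one descends by
    [V t 1 n] = ([V t 1 (n-1)] + [V t 2 n]) : h,
    [V (t-1) 2 (n-1)] = ([V t 1 (n-1)] + [V t 2 n]) : h',
    [V (t-1) 1 (n-1)] = ([V t 1 n] + [V (t-1) 2 (n-1)]) : h'',
    and symmetrically for [V (t-1) 2 n].  In each case the multiplier is a minor
    outside the prime on the left, and the product of the multiplier with a
    generator is placed in the sum by exchanging one row between two
    determinants. *)

(** * Exchanging rows between two determinants *)

Section Determinants.
Variable R : comNzRingType.

Lemma mulmx_adj_replace_row (n : nat) (A B : 'M[R]_n) (i j : 'I_n) :
  (A *m \adj B) i j =
  \det (\matrix_(p, q) if p == j then A i q else B p q).
Proof.
rewrite mxE (expand_det_row _ j); apply: eq_bigr => q _.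
rewrite !mxE eqxx; congr (_ * _); rewrite /cofactor; congr (_ * \det _).
by apply/matrixP => k l; rewrite !mxE eq_sym (negbTE (neq_lift _ _)).
Qed.

(** Both sides are the [(k, k)] entry of [Z *m \adj Y *m Y *m \adj Z]: the inner [\adj Y *m Y] is
    the scalar [\det Y], while the entries of the two outer halves are row replacements by Cramer's
    rule. *)
Lemma det_exchange (n : nat) (Y Z : 'M[R]_n) (k : 'I_n) :
  \det Y * \det Z =
  \sum_j \det (\matrix_(p, q) if p == j then Z k q else Y p q)
       * \det (\matrix_(p, q) if p == k then Y j q else Z p q).
Proof.
have E : (Z *m \adj Y *m (Y *m \adj Z)) k k = \det Y * \det Z.
  rewrite -mulmxA (mulmxA (\adj Y)) mul_adj_mx mul_scalar_mx -scalemxAr.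
  by rewrite mul_mx_adj !mxE eqxx mulr1n.
rewrite -E mxE; apply: eq_bigr => j _.
by rewrite !mulmx_adj_replace_row.
Qed.

(** Bordering by a unit row lets a minor of size [s] exchange rows with a determinant of size
    [s + 1]; [p.-1] undoes the shift caused by the border. *)
Lemma det_unit_row (s : nat) (k : 'I_s.+1) (G : nat -> nat -> R) :
  \det (\matrix_(p < s.+1, q < s.+1)
          if p == ord0 then (q == k)%:R else G p.-1 q) =
  (-1) ^+ k * \det (\matrix_(i < s, j < s) G i (lift k j)).
Proof.
rewrite (expand_det_row _ ord0) (bigD1 k) //= !mxE !eqxx mul1r big1 => [|q /negbTE qk].
  rewrite addr0 /cofactor; congr (_ * \det _).
  by apply/matrixP => i j; rewrite !mxE.
by rewrite !mxE qk eqxx mul0r.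
Qed.

End Determinants.

(** * A strict rearrangement inequality for sums of squares *)

Section Rearrangement.
Variables (t : nat) (r c : 'I_t -> nat).
Hypothesis r_incr : forall i j : 'I_t, (i < j)%N -> (r i < r j)%N.
Hypothesis c_incr : forall i j : 'I_t, (i < j)%N -> (c i < c j)%N.

Lemma perm_id_no_inversion (s : {perm 'I_t}) :
  (forall i j : 'I_t, (i < j)%N -> (s i < s j)%N) -> s = 1%g.
Proof.
move=> H.
have H1 n (i : 'I_t) : (i < n)%N -> (i <= s i)%N.
  elim: n i => // n IH i; rewrite ltnS => le_in.
  case: i le_in => [[|i] hi] le_in //=.
  have hi' : (i < t)%N by lia.
  have := IH (Ordinal hi') le_in; have := H (Ordinal hi') (Ordinal hi) => /=; lia.
have H2 n (i : 'I_t) : (t - i < n)%N -> (s i <= i)%N.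
  elim: n i => // n IH i; rewrite ltnS => le_in.
  case: (ltnP i.+1 t) => [hi'|]; last by have := ltn_ord (s i); lia.
  have := IH (Ordinal hi'); have := H i (Ordinal hi') => /=; lia.
apply/permP => i; rewrite perm1; apply/val_inj/eqP.
by rewrite eqn_leq (H1 i.+1) // (H2 (t - i).+1).
Qed.

Let W (s : {perm 'I_t}) := (\sum_i (r i + c (s i)) ^ 2)%N.

(** Removing the inversion raises the sum by [2 (r j - r i) (c (s i) - c (s j))]. *)
Lemma swap_inversion (s : {perm 'I_t}) (i j : 'I_t) :
  (i < j)%N -> (s j < s i)%N -> (W s < W (tperm i j * s)%g)%N.
Proof.
move=> ij sij; have nij : j != i by apply: contraTneq ij => ->; rewrite ltnn.
rewrite /W (bigD1 i) // (bigD1 j) //= [X in (_ < X)%N](bigD1 i) // (bigD1 j) //=.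
rewrite !permM tpermL tpermR.
rewrite [X in (_ < _ + (_ + X))%N](eq_bigr (fun k => (r k + c (s k)) ^ 2)%N); last first.
  by move=> k /andP[ki kj]; rewrite permM tpermD // eq_sym.
have := r_incr ij; have := c_incr sij.
set S := (\sum_(_ | _) _)%N; nia.
Qed.

(** A maximiser of [W] has no inversion, so it is the identity; a permutation reaching that value
    would be a maximiser too. *)
Lemma rearrangement_square (s : {perm 'I_t}) : s != 1%g ->
  (\sum_i (r i + c (s i)) ^ 2 < \sum_i (r i + c i) ^ 2)%N.
Proof.
have max_id u : (forall v, W v <= W u)%N -> u = 1%g.
  move=> umax; apply: perm_id_no_inversion => i j ij.
  rewrite ltnNge; apply/negP => le_u.
  have : (u j < u i)%N.
    rewrite ltn_neqAle le_u andbT; apply: contraTneq ij.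
    by move/val_inj/perm_inj ->; rewrite ltnn.
  move/(swap_inversion ij); have := umax (tperm i j * u)%g; lia.
case: (@arg_maxnP _ 1%g xpredT W isT) => u _ umax.
have u1 := max_id u (fun v => umax v isT); rewrite {}u1 in umax.
have E : W 1%g = (\sum_i (r i + c i) ^ 2)%N.
  by apply: eq_bigr => i _; rewrite perm1.
move=> s1; rewrite -E -[X in (X < _)%N]/(W s) ltnNge; apply: contra s1 => le_s.
by apply/eqP/max_id => v; apply: leq_trans le_s; apply: umax.
Qed.

End Rearrangement.

(** * Chains of indices with gaps at least 2 *)

Definition gap2 : rel nat := fun x y => (x.+2 <= y)%N.

Lemma gap2_trans : transitive gap2.
Proof. move=> y x z; rewrite /gap2; lia. Qed.

(** Greedy choice makes one sequence serve twice: it is a chain for [gap2], and the pairs [{f, f+1}]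
    of its elements cover all indices of the window that satisfy [P]. The inner test on [L1] keeps
    the jump by 2 structurally recursive. *)
Fixpoint greedy (P : pred nat) (a L : nat) : seq nat :=
  match L with
  | 0 => [::]
  | L1.+1 =>
    if P a then a :: (if L1 is L2.+1 then greedy P a.+2 L2 else [::])
    else greedy P a.+1 L1
  end.

Section Greedy.
Variable P : pred nat.

Lemma greedy_path (a L x : nat) : (x.+2 <= a)%N -> path gap2 x (greedy P a L).
Proof.
elim/ltn_ind: L a x => -[|L] IH a x //= xa.
case: (P a); last by apply: IH => //; lia.
rewrite /= /gap2 xa /=; case: L IH => [|L] IH //.
by apply: IH; lia.
Qed.

Lemma greedy_sorted (a L : nat) : sorted gap2 (greedy P a L).
Proof.
elim/ltn_ind: L a => -[|L] IH a //=; case: (P a); last exact: IH.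
by case: L IH => [|L] IH //=; apply: greedy_path.
Qed.

Lemma greedy_range (a L : nat) :
  all (fun k => (a <= k < a + L)%N && P k) (greedy P a L).
Proof.
elim/ltn_ind: L a => -[|L] IH a //=.
case Pa: (P a); last first.
  apply: sub_all (IH L _ a.+1) => // k /andP[h ->]; lia.
rewrite /= Pa; apply/andP; split; first by lia.
case: L IH => [|L] IH //; apply: sub_all (IH L _ a.+2) => [k /andP[h ->]|]; lia.
Qed.

Lemma greedy_cover (a L k : nat) : (a <= k < a + L)%N -> P k ->
  exists2 f, f \in greedy P a L & (k == f) || (k == f.+1).
Proof.
elim/ltn_ind: L a => -[|L] IH a /= ak Pk; first lia.
case Pa: (P a); last first.
  have ka : k != a by apply: contraFneq Pa => <-.
  by apply: IH => //; lia.
have [->|ka] := eqVneq k a; first by exists a; rewrite ?mem_head ?eqxx.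
have [->|ka1] := eqVneq k a.+1; first by exists a; rewrite ?mem_head ?eqxx ?orbT.
case: L IH ak => [|L] IH ak; first lia.
have [||f fin kf] := IH L _ a.+2 _ Pk; try lia.
by exists f => //; rewrite inE fin orbT.
Qed.

End Greedy.

Lemma sum_ord_extend (V : nmodType) (G : nat -> V) (n m : nat) :
  (n <= m)%N -> (forall l, (n <= l)%N -> G l = 0) ->
  \sum_(l < m) G l = \sum_(l < n) G l.
Proof.
move=> nm H; rewrite (big_ord_widen m G nm) [RHS]big_mkcond /=.
by apply: eq_bigr => l _; case: ltnP => // /H.
Qed.

(** * The prime ideals of Hankel matrices of bounded rank *)

Section HankelVariety.
Variables (K : fieldType) (N : nat).
Local Notation S := {mpoly K[N]}.
Local Notation x := (xvar K N).

Lemma xvar_ord (i : 'I_N) : x i.+1 = 'X_i.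
Proof. by rewrite /xvar valK. Qed.

Lemma xvar_nat (k : nat) : (0 < k <= N)%N -> exists2 i : 'I_N, k = i.+1 & x k = 'X_i.
Proof.
case: k => // k /= hk; exists (Ordinal hk) => //.
by rewrite -xvar_ord.
Qed.

Definition hankel_param (t a b : nat) (R : pzSemiRingType) (u v z : 'I_N -> R) (i : 'I_N) : R :=
  if (a <= i.+1 <= b)%N then \sum_(l < N | (l < t.-1)%N) u l * v l ^+ i.+1 else z i.

Local Notation T := {mpoly K[N + N + N]}.
Let gen (t a b : nat) : 'I_N -> T :=
  hankel_param t a b (fun l => 'X_(lshift N (lshift N l))) (fun l => 'X_(lshift N (rshift N l)))
    (fun i => 'X_(rshift (N + N) i)).

(* The prime ideal of the closure of the Hankel matrices in x_a, ..., x_b of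
   rank < t, which are generically sums of t - 1 geometric progressions. *)
Definition hankel_prime (t a b : nat) : S -> Prop :=
  fun p => mmap (@mpolyC (N + N + N) K) (gen t a b) p = 0.

Lemma hankel_prime_ideal (t a b : nat) : is_ideal (hankel_prime t a b).
Proof.
split=> [|p q hp hq|p q hq]; rewrite /hankel_prime ?rmorph0 // ?rmorphD ?rmorphM /=.
  by rewrite hp hq addr0.
by rewrite hq mulr0.
Qed.

Lemma hankel_primeP (t a b : nat) (p q : S) :
  hankel_prime t a b (p * q) -> ~ hankel_prime t a b p -> hankel_prime t a b q.
Proof.
rewrite /hankel_prime rmorphM => /eqP; rewrite mulf_eq0 => /orP[] /eqP //.
Qed.

Lemma hankel_prime_param (t a b : nat) (R : comNzRingType) (f : {rmorphism K -> R})
    (u v z : 'I_N -> R) (p : S) :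
  hankel_prime t a b p -> mmap f (hankel_param t a b u v z) p = 0.
Proof.
pose h (i : 'I_(N + N + N)) : R :=
  match split i with
  | inl i1 => match split i1 with inl l => u l | inr l => v l end
  | inr i2 => z i2
  end.
have hu l : h (lshift N (lshift N l)) = u l.
  by rewrite /h (unsplitK (inl _)) (unsplitK (inl l)).
have hv l : h (lshift N (rshift N l)) = v l.
  by rewrite /h (unsplitK (inl _)) (unsplitK (inr l)).
have hz l : h (rshift (N + N) l) = z l by rewrite /h (unsplitK (inr l)).
have E i : mmap f h (gen t a b i) = hankel_param t a b u v z i.
  rewrite /gen /hankel_param; case: ifP => _; last by rewrite mmapX mmap1U hz.
  rewrite rmorph_sum; apply: eq_bigr => l _.
  by rewrite rmorphM rmorphXn /= !mmapX !mmap1U hu hv.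
move/(congr1 (mmap f h)); rewrite rmorph0 => <-.
rewrite [mmap _ (gen _ _ _) p]/mmap rmorph_sum [LHS]/mmap; apply: eq_bigr => m _ /=.
rewrite rmorphM /= mmapC; congr (_ * _).
by rewrite /mmap1 rmorph_prod; apply: eq_bigr => i _; rewrite rmorphXn /= E.
Qed.

(** Under the parametrisation the matrix factors as [A *m B] through [t - 1] progressions, with
    [u l * v l ^+ r i] in [A] and [v l ^+ c j] in [B]. Padded to size [t], [A] has a zero last
    column. *)
Lemma hankel_prime_det (t a b : nat) (r c : 'I_t -> nat) :
  (0 < t)%N -> (0 < a)%N -> (b <= N)%N ->
  (forall i j, a <= r i + c j <= b)%N ->
  hankel_prime t a b (\det (\matrix_(i, j) x (r i + c j))).
Proof.
move=> t0 a0 bN H; rewrite /hankel_prime -det_map_mx.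
pose u (l : 'I_N) : T := 'X_(lshift N (lshift N l)).
pose v (l : 'I_N) : T := 'X_(lshift N (rshift N l)).
pose F (e l : nat) : T :=
  if insub l is Some l' then u l' * v l' ^+ e else 0.
pose G (e l : nat) : T := if (l < t.-1)%N then F e l else 0.
pose A : 'M[T]_t := \matrix_(i, l) G (r i) l.
pose B : 'M[T]_t := \matrix_(l, j) (if insub (l : nat) is Some l' then v l' ^+ c j else 0).
have -> : map_mx (mmap (@mpolyC (N + N + N) K) (gen t a b)) (\matrix_(i, j) x (r i + c j))
        = A *m B.
  apply/matrixP => i j; rewrite !mxE.
  have hij : (0 < r i + c j <= N)%N by have := H i j; lia.
  have [k ek ->] := xvar_nat hij.
  rewrite mmapX mmap1U /gen /hankel_param -ek H big_mkcond.
  rewrite (eq_bigr (fun l : 'I_N => G (r i + c j)%N l)); last first.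
    by move=> l _; rewrite /G /F valK.
  rewrite [RHS](eq_bigr (fun l : 'I_t => G (r i + c j)%N l)); last first.
    move=> l _; rewrite !mxE /G /F; case: ifP => _; last by rewrite mul0r.
    case: insubP => [l' _ _|_]; last by rewrite mulr0.
    by rewrite exprD mulrA.
  rewrite -(@sum_ord_extend _ (G _) N (N + t)) ?leq_addr //; last first.
    by move=> l lN; rewrite /G /F insubN -?leqNgt ?if_same.
  rewrite -(@sum_ord_extend _ (G _) t (N + t)) ?leq_addl // => l tl.
  by rewrite /G ltnNge (leq_trans (leq_pred t) tl).
have tl : (t.-1 < t)%N by rewrite prednK.
rewrite det_mulmx (expand_det_col A (Ordinal tl)) big1 ?mul0r // => i _.
by rewrite mxE /G /= ltnn mul0r.
Qed.

End HankelVariety.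

Lemma seq_max (T : eqType) (W : T -> nat) (s : seq T) : s != [::] ->
  exists2 x0, x0 \in s & forall y, y \in s -> (W y <= W x0)%N.
Proof.
elim: s => // x [|x' s] IH _.
  by exists x => [|y]; rewrite inE // => /eqP ->.
have [//|x0 x0s H] := IH.
have [le|lt] := leqP (W x) (W x0).
  exists x0 => [|y]; first by rewrite inE x0s orbT.
  by rewrite inE => /predU1P[-> //|/H].
exists x => [|y]; first by rewrite mem_head.
by rewrite inE => /predU1P[-> //|/H le]; apply: leq_trans le (ltnW lt).
Qed.

(** * Degree bounds with a marked top coefficient *)

Section TopCoefficient.
Variable R : comNzRingType.

(** Here [c] may be 0, so [d] only bounds the degree; this makes the notion stable under sums with
    cancellation. *)
Definition has_top (d : nat) (p : {poly R}) (c : R) : Prop :=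
  (size p <= d.+1)%N /\ p`_d = c.

Lemma has_top_mul (d e : nat) (p q : {poly R}) (c c' : R) :
  has_top d p c -> has_top e q c' -> has_top (d + e) (p * q) (c * c').
Proof.
move=> [sp <-] [sq <-]; split.
  by apply: leq_trans (size_polyMleq _ _) _; lia.
have hd : (d < (d + e).+1)%N by lia.
rewrite coefM (bigD1 (Ordinal hd)) //= addKn big1 ?addr0 // => i ni.
have {}ni : (i : nat) != d by [].
have [lt|gt] := ltnP i d.
  by rewrite (nth_default _ (leq_trans sq _)) ?mulr0 //; lia.
by rewrite (nth_default _ (leq_trans sp _)) ?mul0r //; lia.
Qed.

Lemma has_top1 : has_top 0 1 1.
Proof. by split; rewrite ?size_poly1 ?coef1. Qed.

Lemma has_top_exp (d k : nat) (p : {poly R}) (c : R) :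
  has_top d p c -> has_top (d * k) (p ^+ k) (c ^+ k).
Proof.
move=> H; elim: k => [|k IH]; first by rewrite muln0 !expr0; apply: has_top1.
by rewrite mulnS !exprS; apply: has_top_mul.
Qed.

Lemma has_top_mmap1 (N : nat) (d : 'I_N -> nat) (y : 'I_N -> {poly R})
    (g : 'I_N -> R) (m : 'X_{1..N}) :
  (forall i, has_top (d i) (y i) (g i)) ->
  has_top (\sum_i d i * m i)%N (mmap1 y m) (mmap1 g m).
Proof.
move=> H; rewrite /mmap1.
elim: (index_enum _) => [|i s IH]; first by rewrite !big_nil; apply: has_top1.
by rewrite !big_cons; apply: has_top_mul => //; apply: has_top_exp.
Qed.

Lemma has_top_sum (I : Type) (s : seq I) (P : pred I) (d : nat)
    (y : I -> {poly R}) (g : I -> R) :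
  (forall i, P i -> has_top d (y i) (g i)) ->
  has_top d (\sum_(i <- s | P i) y i) (\sum_(i <- s | P i) g i).
Proof.
move=> H; apply: (big_ind2 (has_top d)) => //.
  by split; rewrite ?size_poly0 ?coef0.
move=> p c q c' [sp <-] [sq <-]; split; last by rewrite coefD.
by apply: leq_trans (size_polyD _ _) _; rewrite geq_max sp sq.
Qed.

Lemma has_top_CX (c : R) (d e : nat) : (e <= d)%N ->
  has_top d (c%:P * 'X^e) (if e == d then c else 0).
Proof.
move=> ed; split.
  apply: leq_trans (size_polyMleq _ _) _; rewrite size_polyXn addnS /=.
  by apply: leq_trans (leq_add (size_polyC_leq1 c) (leqnn e)) _.
by rewrite coefCM coefXn eq_sym; case: eqP; rewrite ?mulr1 ?mulr0.
Qed.

End TopCoefficient.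

(** * Chain-free polynomials and the parametrisation *)

Section ChainFree.
Variables (K : fieldType) (N : nat).
Local Notation S := {mpoly K[N]}.

Definition msupport (mm : 'X_{1..N}) (k : nat) : bool :=
  [exists i : 'I_N, (i.+1 == k) && (0 < mm i)%N].

(** Read off the greedy chain: with length at least [t] it provides the diagonal of a minor;
    otherwise fewer than [t] pairs [{f, f+1}] cover the support inside the window, one for each
    progression. *)
Definition chainfree (t a b : nat) (mm : 'X_{1..N}) : bool :=
  (size (greedy (msupport mm) a (b.+1 - a)) < t)%N.

Lemma nth_gap2 (s : seq nat) (i j : nat) : sorted gap2 s ->
  (i < j < size s)%N -> ((nth 0 s i).+2 <= nth 0 s j)%N.
Proof.
move=> ss ij; apply: (sorted_ltn_nth gap2_trans 0%N ss); rewrite ?inE; lia.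
Qed.

(* The parabola k^2 dominates its chord through f and f + 1 at every natural k,
   with equality only at f and f + 1. *)
Lemma chord_le (E f k : nat) : (f * f.+1 <= E)%N ->
  (E - f * f.+1 + (2 * f + 1) * k <= E + k ^ 2)%N.
Proof.
move=> fE; suff : ((2 * f + 1) * k <= k ^ 2 + f * f.+1)%N by lia.
case: (leqP k f) => kf.
  by have [j ->] : exists j, f = (k + j)%N; [exists (f - k)%N; lia | nia].
by have [j ->] : exists j, k = (f.+1 + j)%N; [exists (k - f.+1)%N; lia | nia].
Qed.

Lemma chord_eq (E f k : nat) : (f * f.+1 <= E)%N ->
  ((E - f * f.+1 + (2 * f + 1) * k)%N == (E + k ^ 2)%N) = (k == f) || (k == f.+1).
Proof.
move=> fE.
have -> : ((E - f * f.+1 + (2 * f + 1) * k)%N == (E + k ^ 2)%N) =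
    ((2 * f + 1) * k == k ^ 2 + f * f.+1)%N by lia.
case: (leqP k f) => kf.
  have [j ->] : exists j, f = (k + j)%N by exists (f - k)%N; lia.
  by apply/idP/idP; nia.
have [j ->] : exists j, k = (f.+1 + j)%N by exists (k - f.+1)%N; lia.
by apply/idP/idP; nia.
Qed.

(* Specialise the l-th geometric progression u_l v_l^k so that it interpolates
   x_f and x_(f+1), for the l-th pair {f, f+1} of a cover of the support of a
   monomial of maximal weight, and rescale by powers of an indeterminate so
   that the top coefficient in position k is x_k. *)
Lemma hankel_prime_chainfree (t a b : nat) (q : S) :
  (t <= N)%N -> (0 < a)%N -> (b <= N)%N ->
  hankel_prime t a b q -> (forall mm, mm \in msupp q -> chainfree t a b mm) -> q = 0.
Proof.
move=> tN a0 bN Vq cf; apply/eqP/negPn/negP; rewrite -msupp_eq0 => q0.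
pose E := (N * N.+1)%N.
pose d (i : 'I_N) := (E + i.+1 ^ 2)%N.
pose wt (mm : 'X_{1..N}) := (\sum_i d i * mm i)%N.
have [mm0 mm0q mm0max] := seq_max wt q0.
pose s := greedy (msupport mm0) a (b.+1 - a).
have ss : sorted gap2 s by apply: greedy_sorted.
have st : (size s < t)%N by apply: cf.
have sr l : (l < size s)%N -> (0 < nth 0 s l <= N)%N.
  move=> ls; have /allP/(_ (nth 0%N s l) (mem_nth 0%N ls)) := greedy_range (msupport mm0) a (b.+1 - a).
  by rewrite -/s => /andP[h _]; lia.
pose F := {fraction S}.
(* The default 1 keeps [v f] nonzero also at [f = N], where [f + 1] is out of range. *)
pose X (k : nat) : F := if (0 < k <= N)%N then tofrac (xvar K N k) else 1.
have X0 k : X k != 0.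
  rewrite /X; case: ifP => [hk|_]; last exact: oner_neq0.
  have [i _ ->] := xvar_nat K hk.
  rewrite tofrac_eq0; apply/eqP => /(congr1 (mcoeff U_(i))).
  by rewrite mcoeffXU eqxx mcoeff0 => /eqP; rewrite oner_eq0.
pose v f : F := X f.+1 / X f.
have v0 f : v f != 0 by rewrite mulf_neq0 ?invr_eq0.
pose u f : F := X f / v f ^+ f.
have uv0 f : u f * v f ^+ f = X f by rewrite divfK // expf_neq0.
have uv1 f : u f * v f ^+ f.+1 = X f.+1.
  by rewrite exprS mulrCA uv0 divfK.
pose U (l : 'I_N) : {poly F} :=
  if (l < size s)%N then (u (nth 0 s l))%:P * 'X^(E - nth 0 s l * (nth 0 s l).+1) else 0.
pose V (l : 'I_N) : {poly F} := (v (nth 0 s l))%:P * 'X^(2 * nth 0 s l + 1).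
pose Z (i : 'I_N) : {poly F} := (X i.+1)%:P * 'X^(d i).
pose cov (k f : nat) := (k == f) || (k == f.+1).
pose good (i : 'I_N) := (a <= i.+1 <= b)%N ==> has (cov i.+1) s.
pose g (i : 'I_N) : F := if good i then tofrac 'X_i else 0.
have topy i : has_top (d i) (hankel_param t a b U V Z i) (g i).
  have XE : X i.+1 = tofrac 'X_i by rewrite -xvar_ord /X ltn_ord.
  rewrite /hankel_param /g /good -XE; case: ifP => [hi|_] /=; last first.
    by have := has_top_CX (X i.+1) (leqnn (d i)); rewrite eqxx.
  (* The gaps of the chain make its pairs disjoint, so a covered index gets its top coefficient from
     exactly one progression. *)
  have -> : (if has (cov i.+1) s then X i.+1 else 0) =
     \sum_(l < N | (l < t.-1)%N)
        (if (l < size s)%N && cov i.+1 (nth 0 s l) then X i.+1 else 0).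
    case: ifP => [/(has_nthP 0%N)[l ls cl]|/hasPn nc]; last first.
      by rewrite big1 // => l _; case: ifP => // /andP[ls]; rewrite (negbTE (nc _ _)) // mem_nth.
    have lN : (l < N)%N by lia.
    rewrite (bigD1 (Ordinal lN)) /=; last by lia.
    rewrite ls cl big1 ?addr0 // => l' /andP[_ nl]; case: ifP => // /andP[ls' cl'].
    have {}nl : (l' : nat) != l by [].
    case: (ltngtP l' l) nl => // ll _.
      have := @nth_gap2 s l' l ss; rewrite ll ls => /(_ isT).
      by move: cl cl'; rewrite /cov; move: (nth 0%N s l) (nth 0%N s l') => n n' /=; lia.
    have := @nth_gap2 s l l' ss; rewrite ll ls' => /(_ isT).
    by move: cl cl'; rewrite /cov; move: (nth 0%N s l) (nth 0%N s l') => n n' /=; lia.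
  apply: has_top_sum => l _; rewrite /U /V; case: ifP => ls /=; last first.
    by rewrite mul0r; split; rewrite ?size_poly0 ?coef0.
  move: (sr _ ls); move: (nth 0%N s l) => f fN.
  have fE : (f * f.+1 <= E)%N by rewrite /E; nia.
  rewrite exprMn -exprM -polyC_exp mulrACA -polyCM -exprD.
  have := has_top_CX (u f * v f ^+ i.+1) (chord_le i.+1 fE).
  rewrite chord_eq // /cov /d; case: ifP => // /orP[] /eqP ->; first by rewrite uv0.
  by rewrite uv1.
pose phi : {rmorphism K -> {poly F}} := (polyC \o (@tofrac S \o @mpolyC N K))%FUN.
have := hankel_prime_param phi U V Z Vq.
(* In degree [wt mm0] lighter monomials disappear, and those of equal weight survive unchanged if
   all their variables are good and give 0 otherwise. The monomial [mm0] survives, its support being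
   covered. *)
move/(congr1 (fun p : {poly F} => p`_(wt mm0))); rewrite coef0 coef_sum.
pose mgood (mm : 'X_{1..N}) := [forall i, (0 < mm i)%N ==> good i].
rewrite (eq_big_seq (fun mm => tofrac
   (if (wt mm == wt mm0) && mgood mm then q@_mm *: 'X_[mm] else 0))); last first.
  move=> mm mmq; rewrite coefCM.
  have [sz] := has_top_mmap1 mm topy; rewrite -/(wt mm) => top.
  have := mm0max _ mmq; rewrite leq_eqVlt => /predU1P[Ew|lt]; last first.
    by rewrite (ltn_eqF lt) /= nth_default ?mulr0 ?tofrac0 // (leq_trans sz).
  rewrite Ew eqxx /= -Ew top; case: ifP => [/forallP gd|/negbT].
    rewrite -mul_mpolyC rmorphM /= mpolyXE_id rmorph_prod; congr (_ * _).
    apply: eq_bigr => i _; rewrite rmorphXn /g /=.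
    by have := gd i; case: (posnP (mm i)) => [-> _|_ /= ->]; rewrite ?expr0.
  rewrite negb_forall => /existsP[i]; rewrite negb_imply => /andP[mi ng].
  rewrite /mmap1 (bigD1 i) //= /g (negbTE ng) expr0n -[_ == _]negbK -lt0n mi.
  by rewrite mul0r mulr0 tofrac0.
rewrite -rmorph_sum => /eqP; rewrite tofrac_eq0 => /eqP/(congr1 (mcoeff mm0)).
rewrite mcoeff0 raddf_sum /= (bigD1_seq mm0) ?msupp_uniq //= eqxx /=.
have -> : mgood mm0.
  apply/forallP => i; apply/implyP => mi; apply/implyP => hi.
  have [||f fs cf'] := @greedy_cover (msupport mm0) a (b.+1 - a) i.+1; first by lia.
    by apply/existsP; exists i; rewrite eqxx.
  by apply/hasP; exists f.
rewrite mcoeffZ mcoeffX eqxx mulr1 big1 => [|mm nmm].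
  by rewrite addr0 => /eqP; rewrite mcoeff_eq0 mm0q.
by case: ifP => _; rewrite ?mcoeff0 // mcoeffZ mcoeffX (negbTE nmm) mulr0.
Qed.

End ChainFree.

(** For [i < j] both [r i + c j] and [r j + c i] lie between the diagonal sums at [i] and [j]. *)
Lemma incr_range (t a b : nat) (r c : 'I_t -> nat) :
  (forall i j : 'I_t, (i < j)%N -> (r i < r j)%N) ->
  (forall i j : 'I_t, (i < j)%N -> (c i < c j)%N) ->
  (forall i, a <= r i + c i <= b)%N -> forall i j, (a <= r i + c j <= b)%N.
Proof.
move=> rI cI H i j; case: (ltngtP i j) => [ij|ji|/val_inj <- //].
  by have := rI _ _ ij; have := cI _ _ ij; have := H i; have := H j; lia.
by have := rI _ _ ji; have := cI _ _ ji; have := H i; have := H j; lia.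
Qed.

(** * Reduction to chain-free monomials by minors *)

Section Spanning.
Variables (K : fieldType) (N t a b : nat).
Local Notation S := {mpoly K[N]}.
Local Notation x := (xvar K N).
Hypotheses (t_gt0 : (0 < t)%N) (tN : (t <= N)%N) (a_gt0 : (0 < a)%N) (bN : (b <= N)%N).

Let w (mm : 'X_{1..N}) := (\sum_(i < N) i.+1 ^ 2 * mm i)%N.

Let wD (m1 m2 : 'X_{1..N}) : w (m1 + m2)%MM = (w m1 + w m2)%N.
Proof. by rewrite /w -big_split; apply: eq_bigr => i _; rewrite mnmDE mulnDr. Qed.

Let wU (i : 'I_N) : w U_(i)%MM = (i.+1 ^ 2)%N.
Proof.
rewrite /w (bigD1 i) //= mnm1E eqxx muln1 big1 ?addn0 // => j ji.
by rewrite mnm1E eq_sym (negbTE ji) muln0.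
Qed.

Let wS (k : nat) (F : 'I_k -> 'I_N) :
  w (\sum_(i < k) U_(F i))%MM = (\sum_(i < k) (F i).+1 ^ 2)%N.
Proof.
apply: (big_ind2 (fun mm n => w mm = n)) => [|m1 n1 m2 n2 <- <-|i _] //.
by rewrite /w big1 // => i _; rewrite mnm0E muln0.
Qed.

(* The diagonal term of a minor has strictly larger weight than the others, so
   minors whose diagonals run over all chains rewrite every monomial to
   chain-free ones. *)
Lemma hankel_prime_sub (I : S -> Prop) :
  is_ideal I ->
  (forall s : seq nat, size s = t -> sorted gap2 s -> all (fun k => a <= k <= b)%N s ->
     exists r c : 'I_t -> nat,
       [/\ forall i j : 'I_t, (i < j)%N -> (r i < r j)%N,
           forall i j : 'I_t, (i < j)%N -> (c i < c j)%N,
           forall i : 'I_t, (r i + c i)%N = nth 0%N s i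
         & I (\det (\matrix_(i, j) x (r i + c j)))]) ->
  forall p, hankel_prime t a b p -> I p.
Proof.
move=> [I0 ID IM] HI.
have [V0 VD VM] := @hankel_prime_ideal K N t a b.
(* Reducing modulo [I] and the prime together keeps the remainder of an element of the prime inside
   the prime, where a chain-free remainder must be 0. *)
pose J p := I p /\ @hankel_prime K N t a b p.
have J0 : J 0 by [].
have JD p q : J p -> J q -> J (p + q) by move=> [? ?] [? ?]; split; auto.
have JM r p : J p -> J (r * p) by move=> [? ?]; split; auto.
pose red p := exists2 q, J (p - q) & forall mm, mm \in msupp q -> chainfree t a b mm.
have redJ p : J p -> red p.
  by move=> Jp; exists 0; rewrite ?subr0 // => mm; rewrite msupp0.
have redD p1 p2 : red p1 -> red p2 -> red (p1 + p2).
  move=> [q1 J1 c1] [q2 J2 c2]; exists (q1 + q2).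
    by rewrite opprD addrACA; apply: JD.
  by move=> mm /msuppD_le; rewrite mem_cat => /orP[/c1|/c2].
have redM c p : red p -> red (c *: p).
  move=> [q Jq cq]; exists (c *: q); last by move=> mm /msuppZ_le /cq.
  by rewrite -scalerBr -mul_mpolyC; apply: JM.
have redX n mm : (w mm < n)%N -> red 'X_[mm].
  elim: n mm => // n IH mm; rewrite ltnS => wn.
  case: (boolP (chainfree t a b mm)) => [cf|].
    exists 'X_[mm] => [|mm']; first by rewrite subrr.
    by rewrite msuppX inE => /eqP ->.
  rewrite /chainfree -leqNgt; set G := greedy _ _ _ => tG.
  have sG : size (take t G) = t by apply: size_takel.
  have gG : sorted gap2 (take t G) by apply: take_sorted; apply: greedy_sorted.
  have aG : all (fun k => (a <= k < a + (b.+1 - a))%N && msupport mm k) (take t G).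
    have := greedy_range (msupport mm) a (b.+1 - a).
    by rewrite -/G -{1}(cat_take_drop t G) all_cat => /andP[].
  have aG' : all (fun k => a <= k <= b)%N (take t G).
    by apply: sub_all aG => k /andP[h _]; lia.
  have [r [c [rI cI rc Idet]]] := HI _ sG gG aG'.
  have gE (i : 'I_t) : (a <= r i + c i <= b)%N /\ msupport mm (r i + c i).
    have hi : (i < size (take t G))%N by rewrite sG.
    rewrite rc; split; first exact: (allP aG' _ (mem_nth 0%N hi)).
    by have /andP[] := allP aG _ (mem_nth 0%N hi).
  have rng := incr_range rI cI (fun i => proj1 (gE i)).
  have Jdet : J (\det (\matrix_(i < t, j < t) x (r i + c j))).
    by split=> //; apply: hankel_prime_det.
  have N0 : (0 < N)%N by apply: leq_trans tN.
  pose o (k : nat) : 'I_N := insubd (Ordinal N0) k.-1.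
  have oE i j : (o (r i + c j)%N).+1 = (r i + c j)%N.
    have h := rng i j; rewrite val_insubd; case: ifP => [_|]; first by rewrite prednK //; lia.
    by lia.
  have xE i j : x (r i + c j) = 'X_(o (r i + c j)%N) by rewrite -xvar_ord oE.
  pose D := (\sum_i U_(o (r i + c i)%N))%MM.
  have Dm : (D <= mm)%MM.
    apply/mnm_lepP => k; rewrite mnm_sumE.
    case: (pickP (fun i => o (r i + c i)%N == k)) => [i0 /eqP i0k|none]; last first.
      by rewrite big1 // => i _; rewrite mnm1E none.
    rewrite (bigD1 i0) //= mnm1E i0k eqxx big1 ?addn0.
      have [_ /existsP[k' /andP[/eqP]]] := gE i0.
      by rewrite -oE i0k => -[/val_inj ->].
    move=> i ni; rewrite mnm1E; case: eqP => // ik.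
    have E : (r i + c i = r i0 + c i0)%N by have := oE i i; rewrite ik -i0k oE.
    case: (ltngtP i i0) ni => [lt|lt|/val_inj -> /eqP //].
      by have := rI _ _ lt; have := cI _ _ lt; lia.
    by have := rI _ _ lt; have := cI _ _ lt; lia.
  pose mon (s : 'S_t) := ((mm - D) + \sum_i U_(o (r i + c (s i))%N))%MM.
  have mon1 : mon 1%g = mm.
    rewrite /mon (eq_bigr (fun i => U_(o (r i + c i)%N)%MM)); last by move=> i _; rewrite perm1.
    exact: submK.
  have wmon s : w (mon s) = (w (mm - D)%MM + \sum_i (r i + c (s i)) ^ 2)%N.
    by rewrite wD wS; congr addn; apply: eq_bigr => i _; rewrite oE.
  have Xdet : 'X_[mm - D] * \det (\matrix_(i < t, j < t) x (r i + c j)) =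
      \sum_(s : 'S_t) (-1) ^+ s *: 'X_[mon s].
    rewrite /determinant mulr_sumr; apply: eq_bigr => s _.
    rewrite mpolyXD (big_morph _ (@mpolyXD N K) (mpolyX0 N K)) -mul_mpolyC rmorphXn rmorphN1 mulrCA.
    by congr (_ * (_ * _)); apply: eq_bigr => i _; rewrite mxE xE.
  have -> : 'X_[mm] = 'X_[mm - D] * \det (\matrix_(i < t, j < t) x (r i + c j))
       + (-1) *: \sum_(s : 'S_t | s != 1%g) (-1) ^+ s *: 'X_[mon s].
    by rewrite Xdet (bigD1 1%g) //= odd_perm1 expr0 scale1r mon1 scaleN1r addrK.
  apply/redD; first exact/redJ/JM.
  apply/redM; apply: big_ind => [||s s1]; [exact/redJ|exact/redD|].
  apply/redM/IH; apply: leq_trans wn.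
  rewrite wmon -[X in (_ < w X)%N]mon1 wmon ltn_add2l.
  rewrite [X in (_ < X)%N](eq_bigr (fun i => (r i + c i) ^ 2)%N); last by move=> i _; rewrite perm1.
  exact: rearrangement_square.
move=> p Vp.
have [q [Iq Vq] cfq] : red p.
  rewrite (mpolyE p); apply: big_ind => [||mm _]; [exact/redJ|exact/redD|].
  by apply/redM; apply: (redX (w mm).+1).
have q0 : q = 0.
  apply: (hankel_prime_chainfree tN a_gt0 bN _ cfq).
  have -> : q = p + (-1) * (p - q) by rewrite mulN1r opprB addrC subrK.
  by apply: VD => //; apply: VM.
by rewrite q0 subr0 in Iq.
Qed.

End Spanning.

Lemma nth_gap2_dist (s : seq nat) (i j : nat) : sorted gap2 s ->
  (i <= j < size s)%N -> (nth 0 s i + 2 * (j - i) <= nth 0 s j)%N.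
Proof.
move=> ss; elim: j => [|j IH] ij; first by (have -> : i = 0%N by lia); rewrite addn0.
have [->|ne] := eqVneq i j.+1; first by rewrite subnn muln0 addn0.
have := @nth_gap2 s j j.+1 ss; have ij' : (i <= j < size s)%N by lia.
have := IH ij'; rewrite ltnSn /=; case/andP: ij => _ -> => + /(_ isT); lia.
Qed.

(** * Ideal arithmetic and row exchange inside an ideal *)

Section Ideals.
Variable R : comNzRingType.

Lemma ideal_gen_ideal (G : R -> Prop) : is_ideal (ideal_gen G).
Proof.
split=> [I [I0 _ _] _ //|p q hp hq I HI HG|r p hp I HI HG]; have [_ ID IM] := HI.
  by apply: ID; [apply: hp|apply: hq].
by apply: IM; apply: hp.
Qed.

Lemma principal_ideal (f : R) : is_ideal (principal f).
Proof. exact: ideal_gen_ideal. Qed.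

Lemma principal_gen (f : R) : principal f f.
Proof. by move=> I _; apply. Qed.

Lemma sum_ideal_ideal (I J : R -> Prop) : is_ideal I -> is_ideal J -> is_ideal (sum_ideal I J).
Proof.
move=> [I0 ID IM] [J0 JD JM]; split.
- by exists 0, 0; rewrite addr0.
- move=> _ _ [a1 [b1 [Ia1 Jb1 ->]]] [a2 [b2 [Ia2 Jb2 ->]]].
  by exists (a1 + a2), (b1 + b2); split; rewrite 1?addrACA; auto.
- move=> r _ [a1 [b1 [Ia1 Jb1 ->]]].
  by exists (r * a1), (r * b1); split; rewrite ?mulrDr; auto.
Qed.

Lemma sum_ideall (I J : R -> Prop) p : is_ideal J -> I p -> sum_ideal I J p.
Proof. by move=> [J0 _ _] Ip; exists p, 0; rewrite addr0. Qed.

Lemma sum_idealr (I J : R -> Prop) p : is_ideal I -> J p -> sum_ideal I J p.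
Proof. by move=> [I0 _ _] Jp; exists 0, p; rewrite add0r. Qed.

Lemma sum_ideal_sub (I J V : R -> Prop) : is_ideal V ->
  (forall p, I p -> V p) -> (forall p, J p -> V p) -> forall p, sum_ideal I J p -> V p.
Proof. by move=> [_ VD _] IV JV _ [p [q [Ip Jq ->]]]; apply: VD; auto. Qed.

Lemma ideal_sum (I : R -> Prop) (n : nat) (F : 'I_n -> R) : is_ideal I ->
  (forall i, I (F i)) -> I (\sum_i F i).
Proof. by move=> [I0 ID _] H; apply: big_ind. Qed.

Lemma ideal_signM (I : R -> Prop) (n : nat) (p : R) : is_ideal I ->
  I ((-1) ^+ n * p) -> I p.
Proof.
by move=> [_ _ IM] /(IM ((-1) ^+ n)); rewrite mulrA -expr2 sqrr_sign mul1r.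
Qed.

Lemma ideal_quotient_ideal (I : R -> Prop) (h : R) : is_ideal I -> is_ideal (fun p => I (h * p)).
Proof.
move=> [I0 ID IM]; split=> [|p q|r p Ip]; first by rewrite mulr0.
  by rewrite mulrDr; apply: ID.
by rewrite mulrCA; apply: IM.
Qed.

(** Bordering the smaller determinant by the unit row at column [k] equalises the sizes up to sign;
    exchanging that row with each row of [Y] writes the product as a sum of the assumed members. *)
Lemma exchange_in_ideal (I : R -> Prop) (s : nat) (k : 'I_s.+1)
    (G : nat -> nat -> R) (Y : 'M[R]_s.+1) : is_ideal I ->
  (forall j : 'I_s.+1,
    I (\det (\matrix_(p, q) if p == j then (q == k)%:R else Y p q) *
       \det (\matrix_(p, q) if p == ord0 then Y j q else G p.-1 q))) ->
  I (\det (\matrix_(i < s, j < s) G i (lift k j)) * \det Y).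
Proof.
move=> HI H; apply: (@ideal_signM I k) => //.
rewrite mulrA -det_unit_row mulrC (det_exchange _ _ ord0).
apply: ideal_sum => // j.
set A := \det _; set B := \det _; suff [-> ->] :
  (A = \det (\matrix_(p, q) if p == j then (q == k)%:R else Y p q)) /\
  (B = \det (\matrix_(p, q) if p == ord0 then Y j q else G p.-1 q)) by apply: H.
split; congr (\det _); apply/matrixP => p q; rewrite !mxE //.
by case: (p == ord0).
Qed.

Lemma det_reverse_rows (s : nat) (G : nat -> nat -> R) :
  exists e : nat, \det (\matrix_(i < s, j < s) G (s - i.+1)%N j) =
                  (-1) ^+ e * \det (\matrix_(i < s, j < s) G i j).
Proof.
exists (odd_perm (perm (@rev_ord_inj s))).
rewrite -det_perm -det_mulmx -row_permE; congr (\det _).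
by apply/matrixP => i j; rewrite !mxE permE.
Qed.

End Ideals.

(** * Ideal quotients of sums of Hankel primes *)

Section HankelColon.
Variables (K : fieldType) (N : nat).
Local Notation S := {mpoly K[N]}.
Local Notation x := (xvar K N).
Local Notation V := (@hankel_prime K N).

Section Generators.
Variables (t a b : nat).
Hypotheses (t_gt0 : (0 < t)%N) (tN : (t <= N)%N) (a_gt0 : (0 < a)%N) (bN : (b <= N)%N).

Definition minor_rows (r : nat -> nat) : Prop :=
  (forall i j, i <= j < t -> r i + (j - i) <= r j)%N /\
  (forall i j, i < t -> j < t -> a <= r i + j <= b)%N.

(** Consecutive columns suffice: a chain [s] is the diagonal of the rows starting at [s_i - i], and
    gaps at least 2 leave these starts strictly increasing. *)
Lemma hankel_prime_sub_rows (I : S -> Prop) : is_ideal I ->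
  (forall r, minor_rows r -> I (\det (\matrix_(i < t, j < t) x (r i + j)))) ->
  forall p, V t a b p -> I p.
Proof.
move=> HI H; apply: hankel_prime_sub => // s ss gs /allP as_.
pose r i := (nth 0%N s i - i)%N.
have ge i : (i < t)%N -> (a + 2 * i <= nth 0 s i)%N.
  move=> it; have := @nth_gap2_dist s 0 i gs; rewrite ss leq0n it => /(_ isT).
  have /as_ : nth 0%N s 0 \in s by apply: mem_nth; rewrite ss.
  by move: (nth 0%N s 0) (nth 0%N s i) => u v; lia.
have rr i j : (i <= j < t)%N -> (r i + (j - i) <= r j)%N.
  move=> ij; have := @nth_gap2_dist s i j gs; rewrite ss ij => /(_ isT).
  have := ge i; have := ge j; rewrite /r.
  by move: (nth 0%N s i) (nth 0%N s j) => u v; lia.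
have rI (i j : 'I_t) : (i < j)%N -> (r i < r j)%N.
  by move=> ij; have := rr i j; have := ltn_ord j; lia.
have rE (i : 'I_t) : (r i + i)%N = nth 0%N s i.
  by have := ge i (ltn_ord i); rewrite /r; move: (nth 0%N s i) => u; lia.
exists (fun i => r i), (fun i => val i); split => //.
apply: H; split=> // i j it jt.
apply: (@incr_range t a b (fun i => r i) (fun i => val i) _ _ _ (Ordinal it) (Ordinal jt)) => //.
by move=> k; rewrite rE; apply: as_; apply: mem_nth; rewrite ss.
Qed.

(** Vanishing at a point defines an ideal, so it need only be checked on minors. A polynomial with
    nonzero value there is then outside the prime. *)
Lemma hankel_prime_point (z : nat -> K) (p : S) :
  (forall r, minor_rows r -> \det (\matrix_(i < t, j < t) z (r i + j)%N) = 0) ->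
  V t a b p -> p.@[fun i : 'I_N => z i.+1] = 0.
Proof.
move=> H; apply: (hankel_prime_sub_rows (I := fun p : S => p.@[fun i : 'I_N => z i.+1] = 0)).
  split=> [|p1 p2 h1 h2|p1 p2 h2]; first exact: meval0.
    by rewrite mevalD h1 h2 addr0.
  by rewrite mevalM h2 mulr0.
move=> r hr; rewrite -det_map_mx -(H _ hr); congr (\det _); apply/matrixP => i j.
rewrite !mxE; have [_ /(_ i j (ltn_ord i) (ltn_ord j)) rng] := hr.
have h : (0 < r i + j <= N)%N by lia.
by have [k -> ->] := xvar_nat K h; exact: mevalXU.
Qed.

(** One inclusion is primality with [h] outside, the other is checked on generating minors.
    Extensionality gives an equality of predicates, which can be rewritten inside [in_Cf]. *)
Lemma colon_hankel_prime (I : S -> Prop) (h : S) : is_ideal I ->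
  (forall p, I p -> V t a b p) -> ~ V t a b h ->
  (forall r, minor_rows r -> I (h * \det (\matrix_(i < t, j < t) x (r i + j)))) ->
  colon_ideal I (principal h) = V t a b.
Proof.
move=> HI IV nV H; apply: functional_extensionality => p.
apply: propositional_extensionality; split => [Ip|Vp].
  by apply: hankel_primeP nV; rewrite mulrC; exact: (IV _ (Ip _ (@principal_gen _ h))).
have hp : I (h * p) by apply: (hankel_prime_sub_rows (ideal_quotient_ideal h HI)).
move=> g /(_ (fun g => I (p * g))); apply; first exact: ideal_quotient_ideal.
by move=> _ ->; rewrite mulrC.
Qed.

End Generators.

Lemma meval_det (n : nat) (z : nat -> K) (e : nat -> nat -> nat) :
  (forall i j : nat, i < n -> j < n -> 0 < e i j <= N)%N ->
  (\det (\matrix_(i < n, j < n) x (e i j))).@[fun i : 'I_N => z i.+1] =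
  \det (\matrix_(i < n, j < n) z (e i j)).
Proof.
move=> H; rewrite -det_map_mx; congr (\det _); apply/matrixP => i j; rewrite !mxE.
by have [k -> ->] := xvar_nat K (H i j (ltn_ord i) (ltn_ord j)); exact: mevalXU.
Qed.

Lemma det_row0 (n : nat) (i : nat) (A : nat -> nat -> K) : (i < n)%N ->
  (forall j, (j < n)%N -> A i j = 0) -> \det (\matrix_(i < n, j < n) A i j) = 0.
Proof.
move=> hi H; rewrite (expand_det_row _ (Ordinal hi)) big1 // => j _.
by rewrite mxE H ?mul0r.
Qed.

Lemma hankel_prime_mono (t a b a' b' : nat) : (0 < t <= N)%N ->
  (0 < a' <= a)%N -> (b <= b' <= N)%N -> forall p, V t a b p -> V t a' b' p.
Proof.
move=> ht ha hb; apply: hankel_prime_sub_rows; try lia; first exact: hankel_prime_ideal.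
move=> r [_ rng]; apply: hankel_prime_det => //; try lia.
by move=> i j; have := rng i j (ltn_ord i) (ltn_ord j); lia.
Qed.

(** Expansion along the last column leaves cofactors on the earlier columns only, which stop one
    variable short of [b]. *)
Lemma hankel_prime_last (s a b : nat) (p : S) : (0 < s < N)%N -> (0 < a)%N -> (b <= N)%N ->
  V s.+1 a b p -> V s a b.-1 p.
Proof.
case/andP=> s0 sN a_gt0 bN; move: p.
have HI := @hankel_prime_ideal K N s a b.-1; have [_ _ IM] := HI.
apply: hankel_prime_sub_rows => // r [rI rng].
rewrite (expand_det_col _ ord_max); apply: ideal_sum => // i; apply/IM/IM.
have -> : row' i (col' ord_max (\matrix_(i < s.+1, j < s.+1) x (r i + j))) =
    \matrix_(k, l) x (r (lift i k) + l).
  by apply/matrixP => k l; rewrite !mxE lift_max.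
apply: hankel_prime_det => // [|k l]; first by lia.
have := rng (lift i k) l.+1 (ltn_ord _) (ltn_ord l).
by have := rng (lift i k) 0%N (ltn_ord _) isT; move: (r (lift i k)) => u; rewrite addn0 /=; lia.
Qed.

Lemma hankel_prime_first (s a b : nat) (p : S) : (0 < s < N)%N -> (0 < a)%N -> (b <= N)%N ->
  V s.+1 a b p -> V s a.+1 b p.
Proof.
case/andP=> s0 sN a_gt0 bN; move: p.
have HI := @hankel_prime_ideal K N s a.+1 b; have [_ _ IM] := HI.
apply: hankel_prime_sub_rows => // r [rI rng].
rewrite (expand_det_col _ ord0); apply: ideal_sum => // i; apply/IM/IM.
have -> : row' i (col' ord0 (\matrix_(i < s.+1, j < s.+1) x (r i + j))) =
    \matrix_(k, l) x (r (lift i k) + l.+1).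
  by apply/matrixP => k l; rewrite !mxE.
apply: (@hankel_prime_det K N s a.+1 b (fun k => r (lift i k)) (fun l => l.+1)) => // k l.
have := rng (lift i k) l.+1 (ltn_ord _) (ltn_ord l).
by have := rng (lift i k) 0%N (ltn_ord _) isT; move: (r (lift i k)) => u; rewrite addn0 /=; lia.
Qed.

(* The determinants x_(k - i + j) are, up to sign, the consecutive Hankel minors
   centred at x_k; this row order makes the points below evaluate them to 1. *)
Definition toeplitz (s k : nat) : S := \det (\matrix_(i < s, j < s) x (k - i + j)).

(** At the point where only [x_(N-s+1)] is 1 the matrix is the identity, whereas the first row of an
    [s]-minor in [x_1, ..., x_(N-1)] ends at [x_(N-s)] or earlier and vanishes. *)
Lemma toeplitz_lastN (s : nat) : (0 < s)%N -> (2 * s <= N)%N ->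
  ~ V s 1 N.-1 (toeplitz s (N - s).+1).
Proof.
move=> s0 sN VT; pose z k : K := (k == (N - s).+1)%:R.
have := @hankel_prime_point s 1 N.-1 s0 _ isT (leq_pred N) z _ _ VT.
rewrite /toeplitz (@meval_det s z (fun i j => (N - s).+1 - i + j)%N); last by move=> i j; lia.
have -> : \matrix_(i < s, j < s) z ((N - s).+1 - i + j)%N = 1%:M.
  apply/matrixP => i j; rewrite !mxE /z -val_eqE /=; congr _%:R.
  by have := ltn_ord i; lia.
rewrite det1 => H; have := oner_neq0 K; rewrite H ?eqxx //; first by lia.
move=> r [rI rng]; apply: (@det_row0 s 0 (fun i j => z (r i + j)%N)) => // j js.
have := rI 0%N s.-1; have := rng s.-1 s.-1; rewrite /z => h1 h2.
by case: eqP => // ?; lia.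
Qed.

(** Mirror image, with only [x_s] equal to 1: the last row of an [s]-minor in [x_2, ..., x_N] starts
    at [x_(s+1)] or later. *)
Lemma toeplitz_firstN (s : nat) : (0 < s)%N -> (2 * s <= N)%N ->
  ~ V s 2 N (toeplitz s s).
Proof.
move=> s0 sN VT; pose z k : K := (k == s)%:R.
have := @hankel_prime_point s 2 N s0 _ isT (leqnn N) z _ _ VT.
rewrite /toeplitz (@meval_det s z (fun i j => s - i + j)%N); last by move=> i j; lia.
have -> : \matrix_(i < s, j < s) z (s - i + j)%N = 1%:M.
  apply/matrixP => i j; rewrite !mxE /z -val_eqE /=; congr _%:R.
  by have := ltn_ord i; lia.
rewrite det1 => H; have := oner_neq0 K; rewrite H ?eqxx //; first by lia.
move=> r [rI rng]; apply: (@det_row0 s s.-1 (fun i j => z (r i + j)%N)) => [|j js]; first by lia.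
have := rI 0%N s.-1; have := rng 0%N 0%N; rewrite /z => h1 h2.
by case: eqP => // ?; lia.
Qed.

(* The sequence of period s supported on k = 1 mod s is killed by all minors of
   size s + 1. *)
Lemma toeplitz_midN (s : nat) : (2 * s < N)%N ->
  ~ V s.+1 1 N (toeplitz s s.+1).
Proof.
move=> sN VT; pose z k : K := ((0 < s)%N && (s %| k.-1)%N)%:R.
have := @hankel_prime_point s.+1 1 N isT _ isT (leqnn N) z _ _ VT.
rewrite /toeplitz (@meval_det s z (fun i j => s.+1 - i + j)%N); last by move=> i j; lia.
have -> : \matrix_(i < s, j < s) z (s.+1 - i + j)%N = 1%:M.
  apply/matrixP => i j; rewrite !mxE /z -val_eqE /=; congr _%:R.
  have := ltn_ord i; have := ltn_ord j => hj hi.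
  have -> : (0 < s)%N by lia.
  have -> : ((s.+1 - i + j).-1 = s + j - i)%N by lia.
  case: (ltngtP i j) => ij.
  - have -> : (s + j - i = s + (j - i))%N by lia.
    by rewrite dvdn_addr // gtnNdvd //; lia.
  - by rewrite gtnNdvd //; lia.
  - by rewrite ij addnK dvdnn.
rewrite det1 => H; have := oner_neq0 K; rewrite H ?eqxx //; first by lia.
(* For [s = 0] the multiplier is the empty determinant 1 and the point is the origin. *)
move=> r [rI rng]; case: (posnP s) => [s0|s0].
  by apply: (@det_row0 s.+1 0 (fun i j => z (r i + j)%N)) => // j js; rewrite /z s0.
rewrite -det_tr; apply: (@determinant_alternate _ _ _ ord0 ord_max).
  by rewrite -val_eqE /= neq_ltn s0.
move=> i; rewrite !mxE /z addn0; have := rng i 0%N (ltn_ord i) isT => h.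
have -> : ((r i + s).-1 = (r i).-1 + s)%N by lia.
by rewrite dvdn_addl.
Qed.

(* Rows starting at x_(N-s), x_s, ..., x_1. *)
Definition corner_minor (s : nat) : S :=
  \det (\matrix_(p < s.+1, q < s.+1) x ((if p == 0 :> nat then N - s else s.+1 - p) + q)%N).

(** At the point with [x_s = x_N = 1] and other coordinates 0 the matrix is a permutation matrix,
    while the last row of an [s]-minor in [x_2, ..., x_(N-1)] lies strictly between [x_s] and
    [x_N]. *)
Lemma corner_minorN (s : nat) : (0 < s)%N -> (2 * s + 2 <= N)%N ->
  ~ V s 2 N.-1 (corner_minor s).
Proof.
move=> s0 sN VT; pose z k : K := ((k == s) || (k == N))%:R.
have := @hankel_prime_point s 2 N.-1 s0 _ isT (leq_pred N) z _ _ VT.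
rewrite /corner_minor (@meval_det s.+1 z
  (fun p q => (if p == 0%N :> nat then N - s else s.+1 - p) + q)%N); last first.
  by move=> i j hi hj; case: eqP => ?; lia.
have -> : \matrix_(p < s.+1, q < s.+1)
       z ((if p == 0%N :> nat then N - s else s.+1 - p) + q)%N =
     \matrix_(p < s.+1, q < s.+1)
       if p == ord0 then (q == ord_max)%:R else (q == p.-1 :> nat)%:R.
  apply/matrixP => p q; rewrite !mxE /z -!val_eqE /=.
  have := ltn_ord p; have := ltn_ord q.
  by case: (eqVneq (p : nat) 0%N) => p0 hq hp; congr _%:R; lia.
rewrite (@det_unit_row K s ord_max (fun i q => (q == i)%:R)).
have -> : \matrix_(i < s, j < s) (lift ord_max j == i :> nat)%:R = 1%:M :> 'M[K]_s.
  by apply/matrixP => i j; rewrite !mxE lift_max eq_sym.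
rewrite det1 mulr1 => H; have := oner_neq0 K.
rewrite -(sqrr_sign K s) H ?expr2 ?mul0r ?eqxx //; first by lia.
move=> r [rI rng]; apply: (@det_row0 s s.-1 (fun i j => z (r i + j)%N)) => [|j js]; first by lia.
have := rI 0%N s.-1; have := rng 0%N 0%N; have := rng s.-1 j; rewrite /z => h0 h1 h2.
by case: orP => // -[/eqP|/eqP] ?; lia.
Qed.

(** * Products of the multipliers with generating minors *)

Section Products.
Variable s : nat.
Hypothesis sN : (2 * s + 2 <= N)%N.

Let B := V s.+1 1 N.-1.
Let B' := V s.+1 2 N.

Let HB : is_ideal B. Proof. exact: hankel_prime_ideal. Qed.
Let HB' : is_ideal B'. Proof. exact: hankel_prime_ideal. Qed.
Let HBB : is_ideal (sum_ideal B B'). Proof. exact: sum_ideal_ideal. Qed.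

Lemma det_rows_prime (t a b : nat) (A : 'M[S]_t) (r : nat -> nat) :
  (0 < t)%N -> (0 < a)%N -> (b <= N)%N ->
  (forall i j : 'I_t, A i j = x (r i + j)) ->
  (forall i j, i < t -> j < t -> a <= r i + j <= b)%N -> V t a b (\det A).
Proof.
move=> t0 a0 bN E H.
have -> : A = \matrix_(i, j) x (r i + j) by apply/matrixP => i j; rewrite mxE.
by apply: hankel_prime_det => // i j; apply: H.
Qed.

(** The multiplier has rows starting at [x_2, ..., x_(s+1)]. Joined to them, a row starting at [x_1]
    gives an [(s+1)]-minor avoiding [x_N], and any other row gives one avoiding [x_1]. *)
Lemma mul_toeplitz_mid (r : nat -> nat) : minor_rows s.+1 1 N r ->
  sum_ideal B B' (toeplitz s s.+1 * \det (\matrix_(i < s.+1, j < s.+1) x (r i + j))).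
Proof.
move=> [_ rng]; have [_ _ IM] := HBB.
have -> : toeplitz s s.+1 = \det (\matrix_(i < s, j < s) x (s.+1 - i + lift ord_max j)).
  by congr (\det _); apply/matrixP => i j; rewrite !mxE lift_max.
apply: (exchange_in_ideal (G := fun i q => x (s.+1 - i + q))) => // j; apply: IM.
have hj : (forall q, q < s.+1 -> 0 < r j + q <= N)%N by move=> q; apply: rng.
pose R p := (if p == 0%N then r j else s.+1 - p.-1)%N.
have E (p q : 'I_s.+1) : (\matrix_(p < s.+1, q < s.+1) if p == ord0
       then (\matrix_(i < s.+1, j < s.+1) x (r i + j)) j q else x (s.+1 - p.-1 + q)) p q =
     x (R p + q) by rewrite !mxE -val_eqE /R /=; case: eqP.
have h0 := hj 0%N isT; have hs := hj s (leqnn _).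
have [r1|r1] := eqVneq (r j) 1%N.
  apply: sum_ideall => //; apply: (det_rows_prime (r := R)) => //; first exact: leq_pred.
  by move=> p q hp hq; rewrite /R; case: eqP => ?; lia.
apply: sum_idealr => //; apply: (det_rows_prime (r := R)) => //.
by move=> p q hp hq; rewrite /R; case: eqP => ?; have := hj q hq; lia.
Qed.

(** Exchanging a row of [corner_minor] other than the one reaching [x_N] gives a minor avoiding
    [x_N]. For that row the other factor becomes [toeplitz s s.+1], and [mul_toeplitz_mid] absorbs
    the product. *)
Lemma mul_corner_minor (r : nat -> nat) : (0 < s)%N -> minor_rows s 2 N.-1 r ->
  sum_ideal B B' (corner_minor s * \det (\matrix_(i < s, j < s) x (r i + j))).
Proof.
move=> s0 [_ rng]; have [_ _ IM] := HBB.
have rng' i : (i < s -> 2 <= r i <= N - s)%N.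
  by move=> it; have := rng i 0%N it s0; have := rng i s.-1 it; lia.
have -> : \det (\matrix_(i < s, j < s) x (r i + j)) =
    \det (\matrix_(i < s, j < s) x ((r i).-1 + lift ord0 j)).
  congr (\det _); apply/matrixP => i j; rewrite !mxE /= /bump /=; congr (x _).
  by have := rng' i (ltn_ord i); lia.
rewrite mulrC; apply: (exchange_in_ideal (G := fun i q => x ((r i).-1 + q))) => // j.
pose c p := (if p == 0%N then N - s else s.+1 - p)%N.
pose R p := (if p == 0%N then c j else (r p.-1).-1)%N.
have E (p q : 'I_s.+1) : (\matrix_(p < s.+1, q < s.+1) if p == ord0
       then (\matrix_(p < s.+1, q < s.+1) x (c p + q)) j q else x ((r p.-1).-1 + q)) p q =
     x (R p + q) by rewrite !mxE -val_eqE /R /=; case: eqP.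
have [j0|j0] := eqVneq (j : nat) 0%N; last first.
  apply: IM; apply: sum_ideall => //; apply: (det_rows_prime (r := R)) => //; first exact: leq_pred.
  move=> p q hp hq; rewrite /R /c (negbTE j0); case: eqP => ?; first by have := ltn_ord j; lia.
  by have := rng' p.-1; lia.
have -> : j = ord0 by apply: val_inj.
rewrite (_ : \det (\matrix_(p, q) if p == ord0 then (q == ord0)%:R else _) = toeplitz s s.+1).
  have: V s.+1 1 N (\det (\matrix_(p < s.+1, q < s.+1) if p == ord0
       then (\matrix_(p < s.+1, q < s.+1) x (c p + q)) j q else x ((r p.-1).-1 + q))).
    apply: (det_rows_prime (r := R)) => //.
    move=> p q hp hq; rewrite /R /c j0 eqxx; case: eqP => ?; first by lia.
    by have := rng' p.-1; lia.
  have -> : j = ord0 by apply: val_inj.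
  apply: (@hankel_prime_sub_rows s.+1 1 N _ _ _ _ (fun p => sum_ideal B B' (toeplitz s s.+1 * p))) => //.
    by lia.
    exact: ideal_quotient_ideal.
  exact: mul_toeplitz_mid.
transitivity (\det (\matrix_(p < s.+1, q < s.+1)
    if p == ord0 then (q == ord0)%:R else x (s - p.-1 + q))).
  congr (\det _); apply/matrixP => p q; rewrite !mxE -val_eqE /=.
  by case: eqP => // p0; congr (x _); lia.
rewrite (@det_unit_row _ s ord0 (fun i q => x (s - i + q))) expr0 mul1r.
congr (\det _); apply/matrixP => i j'; rewrite !mxE /= /bump /=; congr (x _).
by have := ltn_ord i; lia.
Qed.

Let A := V s.+1 1 N.
Let C := V s 2 N.-1.
Let HA : is_ideal A. Proof. exact: hankel_prime_ideal. Qed.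
Let HC : is_ideal C. Proof. exact: hankel_prime_ideal. Qed.
Let HAC : is_ideal (sum_ideal A C). Proof. exact: sum_ideal_ideal. Qed.

(** The generator is bordered by a new last column, the multiplier by a new first one. Exchanging a
    genuine row gives an [(s+1)]-minor of the full window; exchanging the unit row leaves an
    [s]-minor avoiding [x_1] and [x_N]. *)
Lemma mul_toeplitz_last (r : nat -> nat) : (0 < s)%N -> minor_rows s 1 N.-1 r ->
  sum_ideal A C (toeplitz s (N - s).+1 * \det (\matrix_(i < s, j < s) x (r i + j))).
Proof.
move=> s0 [_ rng]; have [_ _ IM] := HAC.
have rng' i : (i < s -> 1 <= r i <= N - s)%N.
  by move=> it; have := rng i 0%N it s0; have := rng i s.-1 it; lia.
apply: (@ideal_signM _ _ (@ord_max s)) => //; rewrite mulrCA.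
have -> : \det (\matrix_(i < s, j < s) x (r i + j)) =
    \det (\matrix_(i < s, j < s) x (r i + lift ord_max j)).
  by congr (\det _); apply/matrixP => i j; rewrite !mxE lift_max.
rewrite -(@det_unit_row _ s ord_max (fun i q => x (r i + q))).
have -> : toeplitz s (N - s).+1 = \det (\matrix_(i < s, j < s) x (N - s - i + lift ord0 j)).
  congr (\det _); apply/matrixP => i j; rewrite !mxE /= /bump /=; congr (x _).
  by have := ltn_ord i; lia.
apply: (exchange_in_ideal (G := fun i q => x (N - s - i + q))) => // j; apply: IM.
have [j0|j0] := eqVneq (j : nat) 0%N.
  apply: sum_idealr => //; apply: (@ideal_signM _ _ (@ord_max s)) => //.
  have -> : j = ord0 by apply: val_inj.
  rewrite (_ : \matrix_(p, q) _ = \matrix_(p < s.+1, q < s.+1)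
     if p == ord0 then (q == ord_max)%:R else x (N - s - p.-1 + q)); last first.
    by apply/matrixP => p q; rewrite !mxE eqxx.
  rewrite (@det_unit_row _ s ord_max (fun i q => x (N - s - i + q))); have [_ _ CM] := HC.
  apply/CM/CM; apply: (det_rows_prime (r := fun i => (N - s - i)%N)) => //.
  - exact: leq_pred.
  - by move=> i j'; rewrite !mxE lift_max.
  - by move=> i j' hi hj; lia.
apply: sum_ideall => //; pose R p := (if p == 0%N then r j.-1 else N - s - p.-1)%N.
apply: (det_rows_prime (r := R)) => //.
  by move=> p q; rewrite !mxE -!val_eqE /R /= (negbTE j0); case: eqP.
move=> p q hp hq; rewrite /R; case: eqP => ?; last by lia.
by have := rng' j.-1; have := ltn_ord j; lia.
Qed.

Lemma mul_toeplitz_first (r : nat -> nat) : (0 < s)%N -> minor_rows s 2 N r ->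
  sum_ideal A C (toeplitz s s * \det (\matrix_(i < s, j < s) x (r i + j))).
Proof.
move=> s0 [_ rng]; have [_ _ IM] := HAC.
have rng' i : (i < s -> 2 <= r i <= (N - s).+1)%N.
  by move=> it; have := rng i 0%N it s0; have := rng i s.-1 it; lia.
have -> : \det (\matrix_(i < s, j < s) x (r i + j)) =
    (-1) ^+ (@ord0 s) * \det (\matrix_(i < s, j < s) x ((r i).-1 + lift ord0 j)).
  rewrite mul1r; congr (\det _); apply/matrixP => i j; rewrite !mxE /= /bump /=; congr (x _).
  by have := rng' i (ltn_ord i); lia.
rewrite -(@det_unit_row _ s ord0 (fun i q => x ((r i).-1 + q))).
have -> : toeplitz s s = \det (\matrix_(i < s, j < s) x (s - i + lift ord_max j)).
  by congr (\det _); apply/matrixP => i j; rewrite !mxE lift_max.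
apply: (exchange_in_ideal (G := fun i q => x (s - i + q))) => // j; apply: IM.
have [j0|j0] := eqVneq (j : nat) 0%N.
  apply: sum_idealr => //.
  have -> : j = ord0 by apply: val_inj.
  rewrite (_ : \matrix_(p, q) _ = \matrix_(p < s.+1, q < s.+1)
     if p == ord0 then (q == ord0)%:R else x (s - p.-1 + q)); last first.
    by apply/matrixP => p q; rewrite !mxE eqxx.
  rewrite (@det_unit_row _ s ord0 (fun i q => x (s - i + q))) mul1r.
  apply: (det_rows_prime (r := fun i => (s - i).+1)) => //.
  - exact: leq_pred.
  - by move=> i j'; rewrite !mxE /= /bump /= addnS.
  - by move=> i j' hi hj; lia.
apply: sum_ideall => //; pose R p := (if p == 0%N then (r j.-1).-1 else s - p.-1)%N.
apply: (det_rows_prime (r := R)) => //.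
  by move=> p q; rewrite !mxE -!val_eqE /R /= (negbTE j0); case: eqP.
move=> p q hp hq; rewrite /R; case: eqP => ?; last by lia.
by have := rng' j.-1; have := ltn_ord j; lia.
Qed.

End Products.

End HankelColon.

(** * Descent on the size of the minors *)

Section Membership.
Variables (K : fieldType) (m : nat).
Hypothesis m_gt0 : (0 < m)%N.
Local Notation N := (2 * m)%N.
Local Notation S := {mpoly K[N]}.
Local Notation x := (xvar K N).
Local Notation V := (@hankel_prime K N).

Let D1 : S := \det (hankel K N 1 m m).
Let D2 : S := \det (hankel K N 2 m m).
Let f : S := D1 * D2.

Lemma in_Cf_colon (I J : S -> Prop) : in_Cf f I -> is_ideal J -> in_Cf f (colon_ideal I J).
Proof. by move=> HI HJ C Cf Cc Cs Ci; exact: (Cc _ _ (HI C Cf Cc Cs Ci)). Qed.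

Lemma in_Cf_sum (I J : S -> Prop) : in_Cf f I -> in_Cf f J -> in_Cf f (sum_ideal I J).
Proof. by move=> HI HJ C Cf Cc Cs Ci; exact: (Cs _ _ (HI C Cf Cc Cs Ci) (HJ C Cf Cc Cs Ci)). Qed.

Lemma D1_prime : V m 1 N.-1 D1.
Proof.
apply: (det_rows_prime (r := fun i => i.+1)) => //; first exact: leq_pred.
  by move=> i j; rewrite mxE.
by move=> i j hi hj; lia.
Qed.

Lemma D2_prime : V m 2 N D2.
Proof.
apply: (det_rows_prime (r := fun i => i.+2)) => //.
  by move=> i j; rewrite mxE.
by move=> i j hi hj; lia.
Qed.

Lemma toeplitz_hankel (c : nat) :
  exists e : nat, toeplitz K N m (c + m.-1) = (-1) ^+ e * \det (hankel K N c m m).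
Proof.
have [e E] := det_reverse_rows m (fun i j => x (c + i + j)).
exists e; rewrite -[\det (hankel _ _ _ _ _)]/(\det (\matrix_(i < m, j < m) x (c + i + j))) -E.
congr (\det _); apply/matrixP => i j; rewrite !mxE; congr (x _).
by have := ltn_ord i; lia.
Qed.

Lemma D2N : ~ V m 1 N.-1 D2.
Proof.
move=> VD; apply: (@toeplitz_lastN K N m m_gt0 (leqnn _)).
have [e E] := toeplitz_hankel 2; have [_ _ IM] := @hankel_prime_ideal K N m 1 N.-1.
have -> : (N - m).+1 = (2 + m.-1)%N by lia.
by rewrite E; apply: IM.
Qed.

Lemma D1N : ~ V m 2 N D1.
Proof.
move=> VD; apply: (@toeplitz_firstN K N m m_gt0 (leqnn _)).
have [e E] := toeplitz_hankel 1; have [_ _ IM] := @hankel_prime_ideal K N m 2 N.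
have -> : toeplitz K N m m = toeplitz K N m (1 + m.-1) by congr toeplitz; lia.
by rewrite E; apply: IM.
Qed.

Lemma principal_sub (V' : S -> Prop) : is_ideal V' -> V' f -> forall p, principal f p -> V' p.
Proof. by move=> HV Vf p /(_ V' HV); apply=> _ ->. Qed.

Lemma in_Cf_top : in_Cf f (V m 1 N.-1) /\ in_Cf f (V m 2 N).
Proof.
have Pf : in_Cf f (principal f) by move=> C.
have [_ _ V1M] := @hankel_prime_ideal K N m 1 N.-1.
have [_ _ V2M] := @hankel_prime_ideal K N m 2 N.
have Hf := @principal_ideal _ f.
split.
  rewrite -(@colon_hankel_prime K N m 1 N.-1 m_gt0 _ isT _ (principal f) D2) //; try lia.
  - by apply: in_Cf_colon => //; apply: principal_ideal.
  - apply: principal_sub; first exact: hankel_prime_ideal.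
    by rewrite /f mulrC; apply: V1M; apply: D1_prime.
  - exact: D2N.
  (* The window of [2m - 1] variables has room for only one choice of rows, so [D1] is the only
     generator. *)
  move=> r [rI rng]; rewrite (_ : \det (\matrix_(i, j) x (r i + j)) = D1).
    by rewrite mulrC; apply: principal_gen.
  congr (\det _); apply/matrixP => i j; rewrite !mxE; congr (x _).
  have := rI 0%N i; have := rI i m.-1; have := rng 0%N 0%N; have := rng m.-1 m.-1.
  by have := ltn_ord i; lia.
rewrite -(@colon_hankel_prime K N m 2 N m_gt0 _ isT _ (principal f) D1) //; try lia.
- by apply: in_Cf_colon => //; apply: principal_ideal.
- apply: principal_sub; first exact: hankel_prime_ideal.
  by rewrite /f; apply: V2M; apply: D2_prime.
- exact: D1N.
move=> r [rI rng]; rewrite (_ : \det (\matrix_(i, j) x (r i + j)) = D2).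
  exact: principal_gen.
congr (\det _); apply/matrixP => i j; rewrite !mxE; congr (x _).
have := rI 0%N i; have := rI i m.-1; have := rng 0%N 0%N; have := rng m.-1 m.-1.
by have := ltn_ord i; lia.
Qed.

(** The case [s = 0] is included: the multiplier is then 1 and the result is the ideal of all
    variables. *)
Lemma in_Cf_full (s : nat) : (s < m)%N ->
  in_Cf f (V s.+1 1 N.-1) -> in_Cf f (V s.+1 2 N) -> in_Cf f (V s.+1 1 N).
Proof.
move=> sm C1 C2.
have HB := @hankel_prime_ideal K N s.+1 1 N.-1; have HB' := @hankel_prime_ideal K N s.+1 2 N.
rewrite -(@colon_hankel_prime K N s.+1 1 N isT _ isT _
  (sum_ideal (V s.+1 1 N.-1) (V s.+1 2 N)) (toeplitz K N s s.+1)) //; try lia.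
- by apply: in_Cf_colon; [apply: in_Cf_sum|apply: principal_ideal].
- exact: sum_ideal_ideal.
- apply: sum_ideal_sub; first exact: hankel_prime_ideal.
    by apply: hankel_prime_mono; lia.
  by apply: hankel_prime_mono; lia.
- by apply: toeplitz_midN; lia.
by move=> r; apply: mul_toeplitz_mid; lia.
Qed.

Lemma in_Cf_step (s : nat) : (0 < s < m)%N ->
  in_Cf f (V s.+1 1 N.-1) -> in_Cf f (V s.+1 2 N) ->
  in_Cf f (V s 1 N.-1) /\ in_Cf f (V s 2 N).
Proof.
case/andP=> s0 sm C1 C2; have CA := in_Cf_full sm C1 C2.
have HB := @hankel_prime_ideal K N s.+1 1 N.-1; have HB' := @hankel_prime_ideal K N s.+1 2 N.
have HA := @hankel_prime_ideal K N s.+1 1 N; have HC := @hankel_prime_ideal K N s 2 N.-1.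
(* The window from 2 to [N - 1] comes first: both outer windows arise from its sum with
   [V s.+1 1 N]. *)
have CC : in_Cf f (V s 2 N.-1).
  rewrite -(@colon_hankel_prime K N s 2 N.-1 s0 _ isT _
    (sum_ideal (V s.+1 1 N.-1) (V s.+1 2 N)) (corner_minor K N s)) //; try lia.
  - by apply: in_Cf_colon; [apply: in_Cf_sum|apply: principal_ideal].
  - exact: sum_ideal_ideal.
  - by apply: sum_ideal_sub => // p; [apply: hankel_prime_first|apply: hankel_prime_last]; lia.
  - by apply: corner_minorN; lia.
  by move=> r; apply: mul_corner_minor; lia.
split.
  rewrite -(@colon_hankel_prime K N s 1 N.-1 s0 _ isT _
    (sum_ideal (V s.+1 1 N) (V s 2 N.-1)) (toeplitz K N s (N - s).+1)) //; try lia.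
  - by apply: in_Cf_colon; [apply: in_Cf_sum|apply: principal_ideal].
  - exact: sum_ideal_ideal.
  - apply: sum_ideal_sub; first exact: hankel_prime_ideal.
      by move=> p; apply: hankel_prime_last; lia.
    by apply: hankel_prime_mono; lia.
  - by apply: toeplitz_lastN; lia.
  by move=> r; apply: mul_toeplitz_last; lia.
rewrite -(@colon_hankel_prime K N s 2 N s0 _ isT _
  (sum_ideal (V s.+1 1 N) (V s 2 N.-1)) (toeplitz K N s s)) //; try lia.
- by apply: in_Cf_colon; [apply: in_Cf_sum|apply: principal_ideal].
- exact: sum_ideal_ideal.
- apply: sum_ideal_sub; first exact: hankel_prime_ideal.
    by move=> p; apply: hankel_prime_first; lia.
  by apply: hankel_prime_mono; lia.
- by apply: toeplitz_firstN; lia.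
by move=> r; apply: mul_toeplitz_first; lia.
Qed.

Lemma in_Cf_hankel_prime (t : nat) : (0 < t <= m)%N -> in_Cf f (V t 1 N).
Proof.
move=> ht; have H k : (k < m)%N -> in_Cf f (V (m - k) 1 N.-1) /\ in_Cf f (V (m - k) 2 N).
  elim: k => [|k IH] km; first by rewrite subn0; apply: in_Cf_top.
  have [|C1 C2] := IH _; first lia.
  have E : (m - k = (m - k.+1).+1)%N by lia.
  by rewrite E in C1 C2; apply: in_Cf_step => //; lia.
have [|C1 C2] := H (m - t)%N _; first lia.
have E : (m - (m - t) = t.-1.+1)%N by lia.
have -> : t = t.-1.+1 by lia.
by rewrite E in C1 C2; apply: in_Cf_full => //; lia.
Qed.

(* An index d splits as 1 + (row floor((d-1)/2)) + (column ceil((d-1)/2)), both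
   strictly increasing along a chain, so all the needed diagonals occur in the
   m x (m+1) matrix. *)
Lemma minor_ideal_hankel_prime (t : nat) : (0 < t <= m)%N ->
  minor_ideal t (hankel K N 1 m m.+1) = V t 1 N.
Proof.
move=> /andP[t0 tm]; apply: functional_extensionality => p.
apply: propositional_extensionality; split => [|Vp].
  apply; first exact: hankel_prime_ideal.
  move=> _ [r [c [rI cI ->]]].
  rewrite (_ : \matrix_(i, j) _ = \matrix_(i, j) x ((1 + r i) + c j)); last first.
    by apply/matrixP => i j; rewrite !mxE.
  apply: (@hankel_prime_det K N t 1 N (fun i => 1 + r i)%N (fun j => c j)) => // i j.
  by have := ltn_ord (r i); have := ltn_ord (c j); lia.
move: p Vp; apply: hankel_prime_sub => //; first by lia.
  exact: ideal_gen_ideal.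
move=> s ss gs /allP as_.
pose e i := (nth 0%N s i).-1.
have eN (i : 'I_t) : (0 < nth 0%N s i <= N)%N by apply: as_; apply: mem_nth; rewrite ss.
have eI (i j : 'I_t) : (i < j)%N -> (e i + 2 <= e j)%N.
  move=> ij; have := @nth_gap2 s i j gs; rewrite ij ss ltn_ord => /(_ isT).
  by have := eN i; have := eN j; rewrite /e; move: (nth 0%N s i) (nth 0%N s j) => u v; lia.
have eM (i : 'I_t) : (e i < N)%N.
  by have := eN i; rewrite /e; move: (nth 0%N s i) => u; lia.
have hr (i : 'I_t) : ((e i)./2 < m)%N by have := eM i; lia.
(* The largest value [e i = 2m - 1] has upper half [m], the index of the last column. *)
have hc (i : 'I_t) : (uphalf (e i) < m.+1)%N by have := eM i; lia.
have rI (i j : 'I_t) : (i < j)%N -> ((e i)./2 < (e j)./2)%N by move=> /eI; lia.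
have cI (i j : 'I_t) : (i < j)%N -> (uphalf (e i) < uphalf (e j))%N by move=> /eI; lia.
exists (fun i => (e i)./2.+1), (fun i => uphalf (e i)); split=> //.
  by move=> i; have := eN i; rewrite /e; move: (nth 0%N s i) => u; lia.
move=> I HI; apply; exists (fun i => Ordinal (hr i)), (fun i => Ordinal (hc i)); split => //.
by congr (\det _); apply/matrixP => i j; rewrite !mxE.
Qed.

End Membership.

(* n = 2m; X = X_m^{(1,n)} has m+1 columns; X_m^{(1,n-1)} and X_m^{(2,n)} are m x m. *)
Theorem theorem3p3 (K : fieldType) (m : nat) (hm : (1 <= m)%N) (t : nat) :
  (1 <= t <= m)%N ->
  in_Cf (\det (hankel K (2 * m) 1 m m) * \det (hankel K (2 * m) 2 m m))
        (minor_ideal t (hankel K (2 * m) 1 m m.+1)).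
Proof.
by move=> ht; rewrite minor_ideal_hankel_prime //; apply: in_Cf_hankel_prime.
Qed.
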